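(* Let $\alpha,\beta>0$ with $\alpha\beta=4\pi^3$. For $0<a<1$, \begin{align*} \sum_{n=1}^{\infty}\frac{\exp(-an^2\alpha)}{1-\exp(-n^2\alpha)}&=\frac{1}{2}\left(a-\frac{1}{2}\right)+\frac{\pi^2}{6\alpha}+\frac{\sqrt{\pi}}{2\sqrt{\alpha}}\bigg\{\sum_{n=1}^{\infty}\frac{\cos(2\pi na)}{\sqrt{n}}\left(\frac{\sinh(\sqrt{n\beta})-\sin(\sqrt{n\beta})}{\cosh(\sqrt{n\beta})-\cos(\sqrt{n\beta})}\right)\\ &\qquad+\sum_{n=1}^{\infty}\frac{\sin(2\pi na)}{\sqrt{n}}\left(\frac{\sinh(\sqrt{n\beta})+\sin(\sqrt{n\beta})}{\cosh(\sqrt{n\beta})-\cos(\sqrt{n\beta})}\right)\bigg\}. \end{align*} In particular, \[ \sum_{n=1}^{\infty}\mathrm{cosech}\left(\frac{n^2\alpha}{2}\right)=\frac{\pi^2}{3\alpha}+\sqrt{\frac{\pi}{\alpha}}\sum_{n=1}^{\infty}\frac{(-1)^n}{\sqrt{n}}\left(\frac{\sinh(\sqrt{n\beta})-\sin(\sqrt{n\beta})}{\cosh(\sqrt{n\beta})-\cos(\sqrt{n\beta})}\right). \] *)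

(* Defs.v *)
From Stdlib Require Import Reals.
From Coquelicot Require Import Coquelicot.
Open Scope R_scope.

Definition ratio_minus (beta : R) (n : nat) : R :=
  let t := sqrt (INR n * beta) in
  (sinh t - sin t) / (cosh t - cos t).

Definition ratio_plus (beta : R) (n : nat) : R :=
  let t := sqrt (INR n * beta) in
  (sinh t + sin t) / (cosh t - cos t).

Definition cosech (x : R) : R := / sinh x.

(* Main.v *)
Require Import Defs.
From Stdlib Require Import Reals Lra Lia.
From Coquelicot Require Import Coquelicot.
Open Scope R_scope.

(* The Fourier series on (0, 1) of a |-> exp(-ax)/(1 - exp(-x)) is
     1/x + sum_(m >= 1) 2 (x cos(2 pi m a) + 2 pi m sin(2 pi m a)) / (x^2 + 4 pi^2 m^2).
   Put x = n^2 alpha and sum over n >= 1. The term 1/x gives pi^2/(6 alpha). For fixed m the sum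
   over n is the Fourier series at 0 of a combination of the real and imaginary parts of
   cosh(tau (1 + i)(t - 1/2)), with tau = sqrt(m beta); it produces the quotients of hyperbolic
   and trigonometric functions, except that the missing n = 0 term leaves a sawtooth series in a,
   which sums to the linear term (a - 1/2)/2. The interchange is only conditionally convergent:
   Abel summation bounds the partial sums over m by a constant over x, uniformly, and Tannery's
   theorem applies. Pointwise convergence of the Fourier series of a differentiable function
   follows from Bessel's inequality applied to the difference quotient. The second identity is the
   case a = 1/2. *)

(** * Integration helpers and Bessel's inequality *)

Lemma is_lim_seq_0_of_sqr (u : nat -> R) :
  is_lim_seq (fun n => u n ^ 2) 0 -> is_lim_seq u 0.
Proof.
  intros H. apply (is_lim_seq_abs_0 u).
  apply is_lim_seq_ext with (fun n => sqrt (u n ^ 2)).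
  - intros n. rewrite <- Rsqr_pow2. apply sqrt_Rsqr_abs.
  - rewrite <- sqrt_0. apply (is_lim_seq_continuous sqrt); [|exact H].
    apply continuity_pt_sqrt. lra.
Qed.

Lemma ex_RInt_continuous_mult (f g : R -> R) (a b : R) :
  (forall t, Rmin a b <= t <= Rmax a b -> continuous f t) ->
  (forall t, Rmin a b <= t <= Rmax a b -> continuous g t) ->
  ex_RInt (fun t => f t * g t) a b.
Proof.
  intros Hf Hg. apply (ex_RInt_continuous (V := R_CompleteNormedModule)).
  intros z Hz. apply (continuous_mult f g); auto.
Qed.

(* Coquelicot states equalities at the carrier of a canonical structure, where ring and field
   do not see the real field. *)
Ltac real_eq := match goal with |- @eq _ ?x ?y => change (@eq R x y) end.

Lemma RInt_ext_all (f g : R -> R) (a b : R) :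
  (forall t, f t = g t) -> RInt f a b = RInt g a b.
Proof. intros H. apply RInt_ext. intros; apply H. Qed.

Lemma is_RInt_lin (f g : R -> R) (a b k lf lg : R) :
  is_RInt f a b lf -> is_RInt g a b lg ->
  is_RInt (fun t => f t + k * g t) a b (lf + k * lg).
Proof.
  intros Hf Hg. apply (is_RInt_plus (V := R_NormedModule)); auto.
  apply (is_RInt_scal (V := R_NormedModule)); auto.
Qed.

Lemma RInt_lin (f g : R -> R) (a b k : R) :
  ex_RInt f a b -> ex_RInt g a b ->
  RInt (fun t => f t + k * g t) a b = RInt f a b + k * RInt g a b.
Proof.
  intros Hf Hg. apply is_RInt_unique, is_RInt_lin;
    now apply (RInt_correct (V := R_CompleteNormedModule)).
Qed.

Lemma ex_RInt_lin (f g : R -> R) (a b k : R) :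
  ex_RInt f a b -> ex_RInt g a b -> ex_RInt (fun t => f t + k * g t) a b.
Proof. intros [u Hu] [v Hv]. eexists. apply is_RInt_lin; eauto. Qed.

(* Subtracting from h its projection on psi_N keeps the inner products with the
   later psi_n and lowers the square norm by the square of the coefficient. *)
Lemma bessel_step (g : R -> R) (psi : nat -> R -> R) (a b c : R) (N : nat) :
  a <= b -> 0 < c ->
  (forall t, a <= t <= b -> continuous g t) ->
  (forall n t, a <= t <= b -> continuous (psi n) t) ->
  (forall m n, m <> n -> RInt (fun t => psi m t * psi n t) a b = 0) ->
  (forall n, RInt (fun t => psi n t * psi n t) a b = c) ->
  exists h : R -> R,
    (forall t, a <= t <= b -> continuous h t) /\
    (forall n, (N <= n)%nat -> RInt (fun t => h t * psi n t) a b
                             = RInt (fun t => g t * psi n t) a b) /\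
    RInt (fun t => h t * h t) a b
    + sum_n (fun n => RInt (fun t => g t * psi n t) a b ^ 2 / c) N
    = RInt (fun t => g t * g t) a b
    + RInt (fun t => g t * psi N t) a b ^ 2 / c.
Proof.
  intros Hab Hc Hg Hpsi Horth Hnorm.
  assert (Hm : forall t, Rmin a b <= t <= Rmax a b -> a <= t <= b).
  { intros t. rewrite Rmin_left, Rmax_right by lra. auto. }
  induction N as [|N [h [Hh [Hin Hsq]]]].
  - exists g. rewrite sum_O. split; [|split]; auto.
  - set (k := RInt (fun t => g t * psi N t) a b) in *.
    assert (Ehp : forall n, ex_RInt (fun t => h t * psi n t) a b)
      by (intros n; apply ex_RInt_continuous_mult; auto).
    assert (Epp : forall m n, ex_RInt (fun t => psi m t * psi n t) a b)
      by (intros m n; apply ex_RInt_continuous_mult; auto).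
    assert (Ehh : ex_RInt (fun t => h t * h t) a b)
      by (apply ex_RInt_continuous_mult; auto).
    exists (fun t => h t - k / c * psi N t). split; [|split].
    + intros t Ht. apply (continuous_minus h (fun t => k / c * psi N t)); [auto|].
      apply (continuous_mult (fun _ => k / c) (psi N)); [apply continuous_const|auto].
    + intros n Hn.
      rewrite (RInt_ext_all _
                 (fun t => h t * psi n t + - (k / c) * (psi N t * psi n t)))
        by (intros; ring).
      rewrite RInt_lin, Horth, Hin by (auto; lia). real_eq. ring.
    + rewrite sum_Sn.
      rewrite (RInt_ext_all _ (fun t => h t * h t + (- 2 * (k / c)) * (h t * psi N t)
                                 + (k / c) ^ 2 * (psi N t * psi N t)))
        by (intros; ring).
      rewrite RInt_lin, RInt_lin, Hnorm, Hin by (auto using ex_RInt_lin).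
      fold k. unfold plus; simpl. fold k in Hsq.
      replace (RInt (fun t => h t * h t) a b)
        with (RInt (fun t => g t * g t) a b + k ^ 2 / c
              - sum_n (fun n => RInt (fun t => g t * psi n t) a b ^ 2 / c) N) by lra.
      simpl. real_eq. field. lra.
Qed.

(** Bessel's inequality: the residual [h] of [bessel_step] has nonnegative square norm, which bounds
    the partial sums of [k n ^ 2 / c]; the terms of a convergent series tend to 0. *)
Lemma bessel_coefficients_lim_0 (g : R -> R) (psi : nat -> R -> R) (a b c : R) :
  a <= b -> 0 < c ->
  (forall t, a <= t <= b -> continuous g t) ->
  (forall n t, a <= t <= b -> continuous (psi n) t) ->
  (forall m n, m <> n -> RInt (fun t => psi m t * psi n t) a b = 0) ->
  (forall n, RInt (fun t => psi n t * psi n t) a b = c) ->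
  is_lim_seq (fun n => RInt (fun t => g t * psi n t) a b) 0.
Proof.
  intros Hab Hc Hg Hpsi Horth Hnorm.
  set (k := fun n => RInt (fun t => g t * psi n t) a b).
  assert (Hpos : forall n, 0 <= k n ^ 2 / c).
  { intros n. apply Rmult_le_pos; [apply pow2_ge_0|left; now apply Rinv_0_lt_compat]. }
  assert (Hex : ex_series (fun n => k n ^ 2 / c)).
  { destruct (ex_finite_lim_seq_incr (sum_n (fun n => k n ^ 2 / c))
                (RInt (fun t => g t * g t) a b)) as [l Hl].
    - intros n. rewrite sum_Sn. unfold plus; simpl. specialize (Hpos (S n)). lra.
    - intros n.
      destruct (bessel_step g psi a b c (S n)) as [h [Hh [_ Hsq]]]; auto.
      rewrite sum_Sn in Hsq. fold (k (S n)) in Hsq.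
      change (fun n : nat => RInt (fun t : R => g t * psi n t) a b ^ 2 / c)
        with (fun n => k n ^ 2 / c) in Hsq.
      unfold plus in Hsq; simpl in Hsq.
      assert (0 <= RInt (fun t => h t * h t) a b).
      { apply RInt_ge_0; auto.
        - apply ex_RInt_continuous_mult; intros t;
            rewrite Rmin_left, Rmax_right by lra; auto.
        - intros; apply Rle_0_sqr. }
      simpl; lra.
    - exists l. exact Hl. }
  apply is_lim_seq_0_of_sqr.
  apply is_lim_seq_ext with (fun n => c * (k n ^ 2 / c)).
  { intros n. fold (k n). real_eq. field. lra. }
  replace (Finite 0) with (Rbar_mult c 0) by (simpl; f_equal; ring).
  apply is_lim_seq_scal_l. now apply ex_series_lim_0.
Qed.

(** * Pointwise convergence of Fourier series *)

(** Carathéodory's form of differentiability: the difference quotient, completed by [l] at [x], is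
    continuous there. *)
Lemma caratheodory (f : R -> R) (x l : R) :
  is_derive f x l ->
  exists p : R -> R, continuous p x /\ p x = l /\ forall t, f t - f x = p t * (t - x).
Proof.
  intros H. apply is_derive_Reals in H.
  exists (fun t => if Req_EM_T t x then l else (f t - f x) / (t - x)).
  split; [|split].
  - apply continuity_pt_filterlim.
    intros eps Heps. destruct (H eps Heps) as [d Hd].
    exists d. split; [apply cond_pos|].
    intros t [[_ Ht] Hlt]. unfold dist in *; simpl in *; unfold R_dist in *.
    destruct (Req_EM_T t x) as [E|E]; [congruence|].
    destruct (Req_EM_T x x) as [_|E']; [|congruence].
    specialize (Hd (t - x)). replace (x + (t - x)) with t in Hd by ring.
    apply Hd; auto. lra.
  - destruct (Req_EM_T x x); congruence.
  - intros t. destruct (Req_EM_T t x) as [->|E]; [ring|]. field. lra.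
Qed.

(** A removable singularity: the Carathéodory slopes [p] of [f] and [q] of [phi] come with the same
    factor [t - x], so [g] agrees near [x] with [p / q], and [q x = m] is nonzero. *)
Lemma continuous_quotient_extension (f phi g : R -> R) (x l m : R) :
  is_derive f x l -> is_derive phi x m -> m <> 0 ->
  f x = 0 -> phi x = 0 -> g x = l / m ->
  (forall t, phi t <> 0 -> g t = f t / phi t) ->
  continuous g x.
Proof.
  intros Hf Hphi Hm Hf0 Hphi0 Hgx Hg.
  destruct (caratheodory f x l Hf) as [p [Hp [Hpx Hpf]]].
  destruct (caratheodory phi x m Hphi) as [q [Hq [Hqx Hqf]]].
  assert (Hloc : locally x (fun t => q t <> 0)).
  { apply (Hq (fun y => y <> 0)). rewrite Hqx. now apply open_neq. }
  apply continuous_ext_loc with (fun t => p t * / q t).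
  - eapply filter_imp; [|exact Hloc]. intros t Ht.
    destruct (Req_EM_T t x) as [->|E].
    + rewrite Hgx, Hpx, Hqx. reflexivity.
    + assert (phi t = q t * (t - x)) by (rewrite <- Hqf, Hphi0; ring).
      assert (f t = p t * (t - x)) by (rewrite <- Hpf, Hf0; ring).
      assert (t - x <> 0) by lra.
      rewrite Hg.
      * rewrite H, H0. real_eq. field. auto.
      * rewrite H. now apply Rmult_integral_contrapositive_currified.
  - apply (continuous_mult p (fun t => / q t)); auto.
    apply continuous_comp; auto.
    apply continuous_Rinv. congruence.
Qed.

(** This and its sine analogue serve twice: to evaluate antiderivatives at [t = 1], and to reflect
    [a] to [1 - a]. *)
Lemma cos_2PI_mult_sub (n : nat) (x : R) : cos (2 * PI * INR n * (1 - x)) = cos (2 * PI * INR n * x).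
Proof.
  replace (2 * PI * INR n * (1 - x)) with (- (2 * PI * INR n * x) + 2 * INR n * PI) by ring.
  now rewrite cos_period, cos_neg.
Qed.

Lemma sin_2PI_mult_sub (n : nat) (x : R) : sin (2 * PI * INR n * (1 - x)) = - sin (2 * PI * INR n * x).
Proof.
  replace (2 * PI * INR n * (1 - x)) with (- (2 * PI * INR n * x) + 2 * INR n * PI) by ring.
  now rewrite sin_period, sin_neg.
Qed.

Lemma is_RInt_derive_R (f df : R -> R) (a b l : R) :
  (forall x, is_derive f x (df x)) -> (forall x, continuous df x) ->
  f b - f a = l -> is_RInt df a b l.
Proof.
  intros Hd Hc <-. apply (is_RInt_derive (V := R_CompleteNormedModule) f); auto.
Qed.

Lemma is_RInt_eq (f : R -> R) (a b l l' : R) : is_RInt f a b l -> l = l' -> is_RInt f a b l'.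
Proof. now intros H <-. Qed.

Lemma is_RInt_const_01 (c : R) : is_RInt (fun _ => c) 0 1 c.
Proof.
  eapply is_RInt_eq; [apply (is_RInt_const (V := R_NormedModule))|].
  compute; ring.
Qed.

Lemma continuous_of_ex_derive (f : R -> R) (x : R) : ex_derive f x -> continuous f x.
Proof. apply (ex_derive_continuous (V := R_NormedModule)). Qed.

Lemma freq_pos (n : nat) : (0 < n)%nat -> 0 < 2 * PI * INR n.
Proof.
  intros H. pose proof PI_RGT_0. apply lt_0_INR in H.
  apply Rmult_lt_0_compat; lra.
Qed.

Lemma is_RInt_cos_freq (n : nat) (a : R) :
  (0 < n)%nat -> is_RInt (fun t => cos (2 * PI * INR n * (t - a))) 0 1 0.
Proof.
  intros Hn. pose proof (freq_pos n Hn).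
  apply is_RInt_derive_R with (fun t => sin (2 * PI * INR n * (t - a)) / (2 * PI * INR n)).
  - intros x. auto_derive; auto. unfold Rminus. field. pose proof PI_RGT_0. split; nra.
  - intros x. apply continuous_of_ex_derive. auto_derive. auto.
  - rewrite sin_2PI_mult_sub.
    replace (2 * PI * INR n * (0 - a)) with (- (2 * PI * INR n * a)) by ring.
    rewrite sin_neg. unfold Rdiv. ring.
Qed.

Lemma sin_mult_sin (x y : R) : sin x * sin y = / 2 * cos (x - y) + - / 2 * cos (x + y).
Proof. rewrite cos_minus, cos_plus. field. Qed.

Lemma is_RInt_cos_freq_Z (m n : nat) (a : R) :
  m <> n -> is_RInt (fun t => cos (2 * PI * (INR m - INR n) * (t - a))) 0 1 0.
Proof.
  intros Hmn. destruct (Nat.lt_total m n) as [H|[H|H]]; [|lia|].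
  - eapply is_RInt_ext; [|apply (is_RInt_cos_freq (n - m) a); lia].
    intros x _. simpl. rewrite minus_INR by lia. rewrite <- cos_neg. f_equal. ring.
  - eapply is_RInt_ext; [|apply (is_RInt_cos_freq (m - n) a); lia].
    intros x _. simpl. rewrite minus_INR by lia. reflexivity.
Qed.

(** The numerator of the Dirichlet kernel centred at [a]; for [n = 0] it is the denominator of that
    kernel. *)
Definition half_wave (a : R) (n : nat) (t : R) : R := sin ((2 * INR n + 1) * (PI * (t - a))).

(** Product-to-sum gives cosines of the nonzero integer frequencies [m - n] and [m + n + 1], which
    integrate to 0 over full periods. *)
Lemma half_wave_orthogonal (a : R) (m n : nat) :
  m <> n -> RInt (fun t => half_wave a m t * half_wave a n t) 0 1 = 0.
Proof.
  intros Hmn. apply is_RInt_unique.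
  apply is_RInt_ext with (fun t => 0 + / 2 * cos (2 * PI * (INR m - INR n) * (t - a))
    + - / 2 * cos (2 * PI * INR (m + n + 1) * (t - a))).
  - intros x _. unfold half_wave. rewrite sin_mult_sin, !plus_INR. simpl (INR 1).
    rewrite Rplus_0_l. f_equal; f_equal; f_equal; ring.
  - eapply is_RInt_eq; [apply is_RInt_lin; [apply is_RInt_lin|]|].
    + apply is_RInt_const_01.
    + now apply is_RInt_cos_freq_Z.
    + apply is_RInt_cos_freq. lia.
    + ring.
Qed.

Lemma half_wave_norm (a : R) (n : nat) :
  RInt (fun t => half_wave a n t * half_wave a n t) 0 1 = / 2.
Proof.
  apply is_RInt_unique.
  apply is_RInt_ext with (fun t => / 2 + - / 2 * cos (2 * PI * INR (n + n + 1) * (t - a))).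
  - intros x _. unfold half_wave. rewrite sin_mult_sin, !plus_INR. simpl (INR 1).
    rewrite Rminus_diag, cos_0. f_equal; [ring|]. f_equal; f_equal; ring.
  - eapply is_RInt_eq; [apply is_RInt_lin|].
    + apply is_RInt_const_01.
    + apply is_RInt_cos_freq. lia.
    + ring.
Qed.

Lemma cos_neq_0_of_sin_0 (x : R) : sin x = 0 -> cos x <> 0.
Proof. intros H H'. pose proof (sin2_cos2 x). rewrite H, H' in H0. unfold Rsqr in H0. lra. Qed.

(* Multiplying the Dirichlet kernel 1 + 2 sum cos(2 pi m s) by sin(pi s) telescopes to
   sin((2M+1) pi s), so the remainder of the M-th partial sum is a Bessel coefficient of the
   continuous extension g of (F - A)/sin(pi(t - a)). *)
Theorem fourier_pointwise (F dF : R -> R) (a A m : R) (c : nat -> R) :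
  (forall t, is_derive F t (dF t)) ->
  (forall t, 0 <= t <= 1 -> sin (PI * (t - a)) = 0 -> F t = A) ->
  is_RInt F 0 1 m ->
  (forall k, is_RInt (fun t => F t * (2 * cos (2 * PI * INR (S k) * (t - a)))) 0 1 (c k)) ->
  is_series c (A - m).
Proof.
  intros HF HA Hm Hc. pose proof PI_RGT_0 as Hpi.
  set (phi := fun t => sin (PI * (t - a))).
  (* At a zero of [phi] the value is the limit predicted by l'Hôpital's rule, which makes [g]
     continuous there. *)
  set (g := fun t => if Req_EM_T (phi t) 0 then dF t / (PI * cos (PI * (t - a)))
                     else (F t - A) / phi t).
  assert (Dphi : forall t, is_derive phi t (PI * cos (PI * (t - a)))).
  { intros t. unfold phi. auto_derive; auto. unfold Rminus. ring. }
  assert (DF : forall t, is_derive (fun t => F t - A) t (dF t)).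
  { intros t. replace (dF t) with (minus (dF t) 0) by (unfold minus, plus, opp; simpl; real_eq; ring).
    apply (is_derive_minus (V := R_NormedModule) F (fun _ => A)); auto.
    apply (is_derive_const (V := R_NormedModule)). }
  assert (Cphi : forall t, continuous phi t)
    by (intros t; apply continuous_of_ex_derive; eexists; apply Dphi).
  assert (CF : forall t, continuous (fun t => F t - A) t)
    by (intros t; apply continuous_of_ex_derive; eexists; apply DF).
  assert (gphi : forall t, 0 <= t <= 1 -> g t * phi t = F t - A).
  { intros t Ht. unfold g. destruct (Req_EM_T (phi t) 0) as [E|E].
    - rewrite E, (HA t Ht E). ring.
    - field. auto. }
  assert (Cg : forall t, 0 <= t <= 1 -> continuous g t).
  { intros t Ht. destruct (Req_EM_T (phi t) 0) as [E|E].
    - apply (continuous_quotient_extension (fun t => F t - A) phi g t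
               (dF t) (PI * cos (PI * (t - a)))); auto.
      + apply Rmult_integral_contrapositive_currified; [lra|].
        now apply cos_neq_0_of_sin_0.
      + rewrite (HA t Ht E). ring.
      + unfold g. destruct (Req_EM_T (phi t) 0); [reflexivity|contradiction].
      + intros s Hs. unfold g. destruct (Req_EM_T (phi s) 0); [contradiction|reflexivity].
    - apply continuous_ext_loc with (fun t => (F t - A) * / phi t).
      + assert (L : locally t (fun s => phi s <> 0))
          by (apply (Cphi t (fun y => y <> 0)); now apply open_neq).
        eapply filter_imp; [|exact L]. intros s Hs. unfold g.
        destruct (Req_EM_T (phi s) 0); [contradiction|reflexivity].
      + apply (continuous_mult (fun t => F t - A) (fun t => / phi t)); auto.
        now apply continuous_Rinv_comp. }
  assert (Chw : forall n t, continuous (half_wave a n) t).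
  { intros n t. apply continuous_of_ex_derive. unfold half_wave. auto_derive. auto. }
  refine (let R_ : nat -> R := fun n => RInt (fun t => g t * half_wave a n t) 0 1 in _).
  assert (HR : is_lim_seq R_ 0).
  { apply bessel_coefficients_lim_0 with (/ 2); auto; try lra.
    - apply half_wave_orthogonal.
    - apply half_wave_norm. }
  assert (Eg : forall n, is_RInt (fun t => g t * half_wave a n t) 0 1 (R_ n)).
  { intros n. apply (RInt_correct (V := R_CompleteNormedModule)).
    apply ex_RInt_continuous_mult; intros t; rewrite Rmin_left, Rmax_right by lra; auto. }
  (* [half_wave a 0] is [phi], so the remainder starts from the integral of [F - A]. *)
  assert (HR0 : R_ 0%nat = m - A).
  { apply is_RInt_unique. apply is_RInt_ext with (fun t => F t - A).
    - intros t. rewrite Rmin_left, Rmax_right by lra. intros Ht.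
      rewrite <- gphi by lra. unfold half_wave, phi. simpl. f_equal. f_equal. ring.
    - apply (is_RInt_minus (V := R_NormedModule) F (fun _ => A)); auto.
      apply is_RInt_const_01. }
  assert (HRS : forall n, R_ (S n) = R_ n + c n).
  { intros n.
    (* The constant [A] in [g t * phi t = F t - A] meets a cosine of mean 0, whence the summand with
       factor 0. *)
    transitivity (R_ n + 1 * c n + - (2 * A) * 0); [|ring].
    apply is_RInt_unique.
    eapply is_RInt_ext; [|apply is_RInt_lin; [apply is_RInt_lin; [apply Eg|apply Hc]|
                           apply (is_RInt_cos_freq (S n) a); lia]].
    intros t. rewrite Rmin_left, Rmax_right by lra. intros Ht. cbv beta.
    assert (E : half_wave a (S n) t - half_wave a n t
                = phi t * (2 * cos (2 * PI * INR (S n) * (t - a)))).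
    { unfold half_wave, phi. rewrite S_INR.
      replace ((2 * (INR n + 1) + 1) * (PI * (t - a)))
        with (2 * PI * (INR n + 1) * (t - a) + PI * (t - a)) by ring.
      replace ((2 * INR n + 1) * (PI * (t - a)))
        with (2 * PI * (INR n + 1) * (t - a) - PI * (t - a)) by ring.
      rewrite sin_plus, sin_minus. ring. }
    replace (half_wave a (S n) t)
      with (half_wave a n t + phi t * (2 * cos (2 * PI * INR (S n) * (t - a)))) by lra.
    transitivity (g t * half_wave a n t
                  + (g t * phi t) * (2 * cos (2 * PI * INR (S n) * (t - a)))); [|real_eq; ring].
    rewrite gphi by lra. real_eq. ring. }
  assert (Hsum : forall n, sum_n c n = R_ (S n) + (A - m)).
  { induction n as [|n IH].
    - rewrite sum_O, HRS, HR0. real_eq. ring.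
    - rewrite sum_Sn, IH, (HRS (S n)). unfold plus; simpl. real_eq. ring. }
  change (is_lim_seq (sum_n c) (A - m)).
  apply is_lim_seq_ext with (fun n => R_ (S n) + (A - m)).
  - intros n. now rewrite Hsum.
  - replace (Finite (A - m)) with (Finite (0 + (A - m))) by (f_equal; ring).
    apply is_lim_seq_plus'; [|apply is_lim_seq_const].
    now apply (is_lim_seq_incr_1 R_ 0) in HR.
Qed.

Lemma is_series_eq (u v : nat -> R) (l l' : R) :
  is_series u l -> (forall n, u n = v n) -> l = l' -> is_series v l'.
Proof. intros H E <-. now apply is_series_ext with u. Qed.

Lemma is_series_lin (u v : nat -> R) (k lu lv : R) :
  is_series u lu -> is_series v lv -> is_series (fun n => u n + k * v n) (lu + k * lv).
Proof.
  intros Hu Hv. apply (is_series_plus (V := R_NormedModule)); auto.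
  apply (is_series_scal_l (V := R_NormedModule)). auto.
Qed.

Lemma is_series_mult_l (u : nat -> R) (k l : R) :
  is_series u l -> is_series (fun n => k * u n) (k * l).
Proof. apply (is_series_scal_l (V := R_NormedModule)). Qed.

Lemma sin_PI_mult_eq_0 (s : R) : -1 < s < 1 -> sin (PI * s) = 0 -> s = 0.
Proof.
  intros Hs H. pose proof PI_RGT_0.
  destruct (Rtotal_order s 0) as [L|[E|G]]; auto.
  - assert (0 < sin (PI * - s)) by (apply sin_gt_0; nra).
    rewrite <- Ropp_mult_distr_r, sin_neg in H1. lra.
  - assert (0 < sin (PI * s)) by (apply sin_gt_0; nra). lra.
Qed.

(** For [a] inside the interval, [t = a] is the only zero of [sin (PI * (t - a))] on [0, 1]. *)
Lemma fourier_interior (F dF : R -> R) (a m : R) (c : nat -> R) :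
  0 < a < 1 ->
  (forall t, is_derive F t (dF t)) ->
  is_RInt F 0 1 m ->
  (forall k, is_RInt (fun t => F t * (2 * cos (2 * PI * INR (S k) * (t - a)))) 0 1 (c k)) ->
  is_series c (F a - m).
Proof.
  intros Ha HF. apply fourier_pointwise with dF; auto.
  intros t Ht Hs. f_equal. apply sin_PI_mult_eq_0 in Hs; lra.
Qed.

(** For [a = 0] the sine vanishes at both ends of [0, 1], so the values of [F] at 0 and 1 must
    agree. *)
Lemma fourier_endpoint (F dF : R -> R) (m : R) (c : nat -> R) :
  F 0 = F 1 ->
  (forall t, is_derive F t (dF t)) ->
  is_RInt F 0 1 m ->
  (forall k, is_RInt (fun t => F t * (2 * cos (2 * PI * INR (S k) * t))) 0 1 (c k)) ->
  is_series c (F 0 - m).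
Proof.
  intros H01 HF Hm Hc. apply fourier_pointwise with F dF 0; auto.
  - intros t Ht. rewrite Rminus_0_r. intros Hs.
    destruct (Req_dec t 1) as [->|N]; auto.
    apply sin_PI_mult_eq_0 in Hs; [now subst|lra].
  - intros k. eapply is_RInt_ext; [|apply Hc]. intros; simpl. now rewrite Rminus_0_r.
Qed.

(** * Special Fourier series *)

Lemma exp_opp_lt_1 (x : R) : 0 < x -> exp (- x) < 1.
Proof. intros H. rewrite <- exp_0. apply exp_increasing. lra. Qed.

(** The shift [S k] makes index 0 stand for the first nonconstant mode. *)
Definition freq (k : nat) : R := 2 * PI * INR (S k).

Lemma freq_gt_0 (k : nat) : 0 < freq k.
Proof. apply freq_pos. lia. Qed.

Lemma cos_freq (k : nat) : cos (freq k) = 1.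
Proof. unfold freq. rewrite <- (Rmult_1_r (_ * _)), <- cos_2PI_mult_sub, Rminus_diag, Rmult_0_r. apply cos_0. Qed.

Lemma sin_freq (k : nat) : sin (freq k) = 0.
Proof.
  pose proof (sin_2PI_mult_sub (S k) 1) as H. rewrite Rminus_diag, Rmult_0_r, sin_0 in H.
  rewrite Rmult_1_r in H. unfold freq. lra.
Qed.

(** With w = [freq k], this is exp(iwa)/(x + iw) plus its complex conjugate, that is, the modes m
    and -m taken together. *)
Definition fourier_term (a x : R) (k : nat) : R :=
  2 * (x * cos (freq k * a) + freq k * sin (freq k * a)) / (x ^ 2 + freq k ^ 2).

(** Fourier series of exp(-xt) at [t = a]: the mean and all coefficients contain the factor 1 -
    exp(-x), which is divided out. *)
Lemma exp_partial_fractions (x a : R) : 0 < x -> 0 < a < 1 ->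
  is_series (fourier_term a x) (exp (- a * x) / (1 - exp (- x)) - / x).
Proof.
  intros Hx Ha. pose proof (exp_opp_lt_1 x Hx).
  apply is_series_eq with
    (fun k => (1 - exp (- x)) * fourier_term a x k * / (1 - exp (- x)))
    ((exp (- x * a) - (1 - exp (- x)) / x) * / (1 - exp (- x))).
  2: { intros k. field. lra. }
  2: { replace (- a * x) with (- x * a) by ring. field. lra. }
  apply (is_series_scal_r (/ (1 - exp (- x)))).
  apply (fourier_interior (fun t => exp (- x * t)) (fun t => - x * exp (- x * t))); auto.
  - intros t. auto_derive; auto. ring.
  - apply is_RInt_derive_R with (fun t => - exp (- x * t) / x).
    + intros t. auto_derive; auto. field. lra.
    + intros t. apply continuous_of_ex_derive. auto_derive. auto.
    + rewrite Rmult_0_r, exp_0, Rmult_1_r. field. lra.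
  - intros k. fold (freq k). pose proof (freq_gt_0 k).
    apply is_RInt_derive_R with (fun t => 2 * exp (- x * t)
       * (freq k * sin (freq k * (t - a)) - x * cos (freq k * (t - a))) / (x ^ 2 + freq k ^ 2)).
    + intros t. auto_derive; auto. unfold Rminus. field. nra.
    + intros t. apply continuous_of_ex_derive. auto_derive. auto.
    + unfold fourier_term, freq.
      rewrite cos_2PI_mult_sub, sin_2PI_mult_sub. fold (freq k).
      rewrite Rmult_0_r, exp_0, Rmult_1_r.
      replace (freq k * (0 - a)) with (- (freq k * a)) by ring.
      rewrite cos_neg, sin_neg. field. nra.
Qed.

(** Fourier series of [t] at the interior point [a], divided by -2. *)
Lemma sawtooth_series (a : R) : 0 < a < 1 ->
  is_series (fun k => sin (freq k * a) / freq k) (/ 2 * (/ 2 - a)).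
Proof.
  intros Ha.
  apply is_series_eq with (fun k => - / 2 * (- 2 * sin (freq k * a) / freq k)) (- / 2 * (a - / 2)).
  2: intros k; field; pose proof (freq_gt_0 k); lra.
  2: field.
  apply is_series_mult_l.
  apply (fourier_interior (fun t => t) (fun _ => 1)); auto.
  - intros t. apply (is_derive_id (K := R_AbsRing)).
  - apply is_RInt_derive_R with (fun t => t ^ 2 / 2).
    + intros t. auto_derive; auto. field.
    + intros t. apply continuous_of_ex_derive. auto_derive. auto.
    + field.
  - intros k. fold (freq k). pose proof (freq_gt_0 k).
    apply is_RInt_derive_R with (fun t => 2 * (t * sin (freq k * (t - a)) / freq k
       + cos (freq k * (t - a)) / freq k ^ 2)).
    + intros t. auto_derive; auto. unfold Rminus. field. lra.
    + intros t. apply continuous_of_ex_derive. auto_derive. auto.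
    + unfold freq.
      rewrite cos_2PI_mult_sub, sin_2PI_mult_sub. fold (freq k).
      replace (freq k * (0 - a)) with (- (freq k * a)) by ring.
      rewrite cos_neg. field. lra.
Qed.

(** Fourier series at 0 of t(1 - t), which vanishes at both ends and has mean 1/6. *)
Lemma basel_series : is_series (fun k => / INR (S k) ^ 2) (PI ^ 2 / 6).
Proof.
  pose proof PI_RGT_0 as Hpi.
  apply is_series_eq with (fun k => - PI ^ 2 * (- 4 / freq k ^ 2)) (- PI ^ 2 * (0 * (1 - 0) - / 6)).
  2: { intros k. unfold freq. pose proof (lt_0_INR (S k) ltac:(lia)). field. lra. }
  2: field.
  apply is_series_mult_l.
  apply (fourier_endpoint (fun t => t * (1 - t)) (fun t => 1 - 2 * t)).
  - ring.
  - intros t. auto_derive; auto. ring.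
  - apply is_RInt_derive_R with (fun t => t ^ 2 / 2 - t ^ 3 / 3).
    + intros t. auto_derive; auto. field.
    + intros t. apply continuous_of_ex_derive. auto_derive. auto.
    + field.
  - intros k. fold (freq k). pose proof (freq_gt_0 k).
    apply is_RInt_derive_R with (fun t => 2 * (t * (1 - t) * sin (freq k * t) / freq k
       + (1 - 2 * t) * cos (freq k * t) / freq k ^ 2 + 2 * sin (freq k * t) / freq k ^ 3)).
    + intros t. auto_derive; auto. unfold Rminus. field. lra.
    + intros t. apply continuous_of_ex_derive. auto_derive. auto.
    + rewrite !Rmult_0_r, !Rmult_1_r, cos_freq, sin_freq, cos_0, sin_0. field. lra.
Qed.

(** * Closed forms of the sums over n *)

Lemma cosh_sqr_sub_sinh_sqr (x : R) : cosh x ^ 2 - sinh x ^ 2 = 1.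
Proof.
  unfold cosh, sinh. rewrite exp_Ropp. field. pose proof (exp_pos x). lra.
Qed.

Lemma sinh_double (x : R) : sinh (2 * x) = 2 * sinh x * cosh x.
Proof.
  unfold cosh, sinh. replace (2 * x) with (x + x) by ring.
  rewrite !exp_Ropp, exp_plus. field. pose proof (exp_pos x). lra.
Qed.

Lemma cosh_double (x : R) : cosh (2 * x) = cosh x ^ 2 + sinh x ^ 2.
Proof.
  unfold cosh, sinh. replace (2 * x) with (x + x) by ring.
  rewrite !exp_Ropp, exp_plus. field. pose proof (exp_pos x). lra.
Qed.

Lemma cosh_neg (x : R) : cosh (- x) = cosh x.
Proof. unfold cosh. rewrite Ropp_involutive. field. Qed.

Lemma sinh_neg (x : R) : sinh (- x) = - sinh x.
Proof. unfold sinh. rewrite Ropp_involutive. field. Qed.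

Lemma sinh_gt_0 (x : R) : 0 < x -> 0 < sinh x.
Proof. intros H. unfold sinh. pose proof (exp_increasing (- x) x). lra. Qed.

(** Put z = tau(1 + i)(t - 1/2). Then [ccos] and [ssin] are the real and imaginary parts of cosh z,
    while [scos] and [csin] are those of sinh z. *)
Definition ccos (tau t : R) : R := cosh (tau * (t - / 2)) * cos (tau * (t - / 2)).
Definition ssin (tau t : R) : R := sinh (tau * (t - / 2)) * sin (tau * (t - / 2)).
Definition scos (tau t : R) : R := sinh (tau * (t - / 2)) * cos (tau * (t - / 2)).
Definition csin (tau t : R) : R := cosh (tau * (t - / 2)) * sin (tau * (t - / 2)).

Lemma is_derive_ccos (tau t : R) :
  is_derive (ccos tau) t (tau * (scos tau t - csin tau t)).
Proof.
  unfold ccos, scos, csin. auto_derive; auto. unfold Rminus. ring.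
Qed.

Lemma is_derive_ssin (tau t : R) :
  is_derive (ssin tau) t (tau * (scos tau t + csin tau t)).
Proof.
  unfold ssin, scos, csin. auto_derive; auto. unfold Rminus. ring.
Qed.

Lemma half_arg_0 (tau : R) : tau * (0 - / 2) = - (tau / 2).
Proof. field. Qed.

Lemma half_arg_1 (tau : R) : tau * (1 - / 2) = tau / 2.
Proof. field. Qed.

(** For lambda = tau(1 + i) one has lambda^2 = 2i tau^2, so this quartic is |lambda^2 + w^2|^2, the
    denominator of the integrals below. *)
Lemma quartic_pos (tau w : R) : 0 < tau -> 0 < w ^ 4 + 4 * tau ^ 4.
Proof. intros Htau. pose proof (pow_lt tau 4 Htau). assert (0 <= w ^ 4) by nra. lra. Qed.

(* The two antiderivatives are the real and imaginary parts of that of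
   cosh(lambda(t - 1/2)) cos(wt) with lambda = tau(1+i). *)
Lemma is_RInt_ccos_cos (tau w : R) : 0 < tau -> cos w = 1 -> sin w = 0 ->
  let P := sinh (tau / 2) * cos (tau / 2) in
  let Q := cosh (tau / 2) * sin (tau / 2) in
  is_RInt (fun t => ccos tau t * cos (w * t)) 0 1
    (2 * tau * (w ^ 2 * (P - Q) + 2 * tau ^ 2 * (P + Q)) / (w ^ 4 + 4 * tau ^ 4)).
Proof.
  intros Htau cos_w sin_w P Q. pose proof (quartic_pos tau w Htau).
  apply is_RInt_derive_R with (fun t =>
    (w ^ 2 * (tau * (scos tau t - csin tau t) * cos (w * t) + w * ccos tau t * sin (w * t))
     + 2 * tau ^ 2 * (tau * (scos tau t + csin tau t) * cos (w * t) + w * ssin tau t * sin (w * t)))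
    / (w ^ 4 + 4 * tau ^ 4)).
  - intros t. unfold ccos, ssin, scos, csin. auto_derive; auto. unfold Rminus. field. lra.
  - intros t. apply continuous_of_ex_derive. unfold ccos. auto_derive. auto.
  - unfold ccos, ssin, scos, csin, P, Q. rewrite half_arg_0, half_arg_1.
    rewrite cosh_neg, sinh_neg, cos_neg, sin_neg, Rmult_0_r, Rmult_1_r, cos_w, sin_w, cos_0, sin_0.
    field. lra.
Qed.

Lemma is_RInt_ssin_cos (tau w : R) : 0 < tau -> cos w = 1 -> sin w = 0 ->
  let P := sinh (tau / 2) * cos (tau / 2) in
  let Q := cosh (tau / 2) * sin (tau / 2) in
  is_RInt (fun t => ssin tau t * cos (w * t)) 0 1
    (2 * tau * (w ^ 2 * (P + Q) - 2 * tau ^ 2 * (P - Q)) / (w ^ 4 + 4 * tau ^ 4)).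
Proof.
  intros Htau cos_w sin_w P Q. pose proof (quartic_pos tau w Htau).
  apply is_RInt_derive_R with (fun t =>
    (w ^ 2 * (tau * (scos tau t + csin tau t) * cos (w * t) + w * ssin tau t * sin (w * t))
     - 2 * tau ^ 2 * (tau * (scos tau t - csin tau t) * cos (w * t) + w * ccos tau t * sin (w * t)))
    / (w ^ 4 + 4 * tau ^ 4)).
  - intros t. unfold ccos, ssin, scos, csin. auto_derive; auto. unfold Rminus. field. lra.
  - intros t. apply continuous_of_ex_derive. unfold ssin. auto_derive. auto.
  - unfold ccos, ssin, scos, csin, P, Q. rewrite half_arg_0, half_arg_1.
    rewrite cosh_neg, sinh_neg, cos_neg, sin_neg, Rmult_0_r, Rmult_1_r, cos_w, sin_w, cos_0, sin_0.
    field. lra.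
Qed.

(** Both functions are even about t = 1/2, so the endpoint values agree. The weights [p] and [q]
    stay free so that a later choice can remove either the [freq k ^ 2] part or the constant part of
    the numerator. The mean is the case w = 0 of the two integrals. *)
Lemma ccos_ssin_series (tau p q : R) : 0 < tau ->
  let P := sinh (tau / 2) * cos (tau / 2) in
  let Q := cosh (tau / 2) * sin (tau / 2) in
  is_series (fun k => 4 * tau * (freq k ^ 2 * (p * (P - Q) + q * (P + Q))
                                 + 2 * tau ^ 2 * (p * (P + Q) - q * (P - Q)))
                      / (freq k ^ 4 + 4 * tau ^ 4))
    (p * (cosh (tau / 2) * cos (tau / 2)) + q * (sinh (tau / 2) * sin (tau / 2))
     - (p * (P + Q) - q * (P - Q)) / tau).
Proof.
  intros Htau P Q.
  set (F := fun t => 0 + p * ccos tau t + q * ssin tau t).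
  apply is_series_eq with (2 := fun n => eq_refl) (l := F 0 - (p * (P + Q) - q * (P - Q)) / tau).
  2: { unfold F, ccos, ssin. rewrite half_arg_0, cosh_neg, sinh_neg, cos_neg, sin_neg. real_eq. ring. }
  apply fourier_endpoint with
    (dF := fun t => p * (tau * (scos tau t - csin tau t)) + q * (tau * (scos tau t + csin tau t))).
  - unfold F, ccos, ssin. rewrite half_arg_0, half_arg_1, cosh_neg, sinh_neg, cos_neg, sin_neg. real_eq. ring.
  - intros t. unfold F.
    apply (is_derive_ext (fun t => p * ccos tau t + q * ssin tau t)); [intros; simpl; real_eq; ring|].
    apply (is_derive_plus (V := R_NormedModule)); apply is_derive_scal.
    + apply is_derive_ccos.
    + apply is_derive_ssin.
  - eapply is_RInt_eq.
    + eapply is_RInt_ext; [|apply is_RInt_lin with (k := q); [apply is_RInt_lin with (k := p)|];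
        [apply (is_RInt_const_01 0)
        |apply (is_RInt_ccos_cos tau 0 Htau cos_0 sin_0)
        |apply (is_RInt_ssin_cos tau 0 Htau cos_0 sin_0)]].
      intros t _. unfold F. cbv beta. rewrite Rmult_0_l, cos_0, !Rmult_1_r. reflexivity.
    + fold P Q. field. lra.
  - intros k. fold (freq k). pose proof (quartic_pos tau (freq k) Htau).
    eapply is_RInt_eq.
    + eapply is_RInt_ext; [|apply is_RInt_lin with (k := (2 * q)); [apply is_RInt_lin with (k := (2 * p))|];
        [apply (is_RInt_const_01 0)
        |apply (is_RInt_ccos_cos tau (freq k) Htau (cos_freq k) (sin_freq k))
        |apply (is_RInt_ssin_cos tau (freq k) Htau (cos_freq k) (sin_freq k))]].
      intros t _. unfold F. cbv beta.
      real_eq. ring.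
    + fold P Q. field. lra.
Qed.

(** With z = tau(1 + i)/2, the bracket is |sinh z|^2. *)
Lemma cosh_sub_cos_half (tau : R) :
  cosh tau - cos tau = 2 * ((sinh (tau / 2) * cos (tau / 2)) ^ 2 + (cosh (tau / 2) * sin (tau / 2)) ^ 2).
Proof.
  replace (cosh tau) with (cosh (2 * (tau / 2))) by (f_equal; field).
  replace (cos tau) with (cos (2 * (tau / 2))) by (f_equal; field).
  rewrite cosh_double, cos_2a_sin. pose proof (cosh_sqr_sub_sinh_sqr (tau / 2)).
  pose proof (sin2_cos2 (tau / 2)). unfold Rsqr in H0.
  replace (cosh (tau / 2) ^ 2) with (1 + sinh (tau / 2) ^ 2) by lra.
  rewrite !Rpow_mult_distr.
  replace (cosh (tau / 2) ^ 2) with (1 + sinh (tau / 2) ^ 2) by lra.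
  replace (cos (tau / 2) ^ 2) with (1 - sin (tau / 2) ^ 2) by (simpl; lra). ring.
Qed.

Lemma cosh_sub_cos_pos (tau : R) : 0 < tau -> 0 < cosh tau - cos tau.
Proof.
  intros Htau. pose proof (sinh_gt_0 (tau / 2) ltac:(lra)).
  pose proof (COS_bound tau).
  replace (cosh tau) with (cosh (2 * (tau / 2))) by (f_equal; field).
  rewrite cosh_double. pose proof (cosh_sqr_sub_sinh_sqr (tau / 2)). nra.
Qed.

(** With z = tau(1 + i)/2, sinh z = P + iQ and cosh z = U + iV; the two equations are the real and
    imaginary parts of sinh z times the conjugate of cosh z. *)
Lemma sinh_sin_half (tau : R) :
  let P := sinh (tau / 2) * cos (tau / 2) in
  let Q := cosh (tau / 2) * sin (tau / 2) in
  let U := cosh (tau / 2) * cos (tau / 2) in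
  let V := sinh (tau / 2) * sin (tau / 2) in
  P * U + Q * V = sinh tau / 2 /\ Q * U - P * V = sin tau / 2.
Proof.
  intros P Q U V.
  replace (sinh tau) with (sinh (2 * (tau / 2))) by (f_equal; field).
  replace (sin tau) with (sin (2 * (tau / 2))) by (f_equal; field).
  rewrite sinh_double, sin_2a.
  pose proof (cosh_sqr_sub_sinh_sqr (tau / 2)) as H1. pose proof (sin2_cos2 (tau / 2)) as H2.
  unfold Rsqr in H2. unfold P, Q, U, V. split.
  - transitivity (sinh (tau / 2) * cosh (tau / 2)
      * (sin (tau / 2) * sin (tau / 2) + cos (tau / 2) * cos (tau / 2))); [ring|].
    rewrite H2. field.
  - transitivity (sin (tau / 2) * cos (tau / 2) * (cosh (tau / 2) ^ 2 - sinh (tau / 2) ^ 2)); [ring|].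
    rewrite H1. field.
Qed.

(** The weights p = P - Q, q = P + Q make p(P + Q) - q(P - Q) vanish, removing the mean and the
    constant part of the numerator, while p(P - Q) + q(P + Q) becomes cosh tau - cos tau. *)
Lemma sinh_sub_sin_series (tau : R) : 0 < tau ->
  is_series (fun k => 8 * tau * freq k ^ 2 / (freq k ^ 4 + 4 * tau ^ 4))
    ((sinh tau - sin tau) / (cosh tau - cos tau)).
Proof.
  intros Htau. pose proof (cosh_sub_cos_pos tau Htau) as HE.
  destruct (sinh_sin_half tau) as [H1 H2]. pose proof (cosh_sub_cos_half tau) as H3.
  set (P := sinh (tau / 2) * cos (tau / 2)) in *.
  set (Q := cosh (tau / 2) * sin (tau / 2)) in *.
  pose proof (is_series_mult_l _ (2 / (cosh tau - cos tau)) _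
                (ccos_ssin_series tau (P - Q) (P + Q) Htau)) as H.
  cbv zeta in H. fold P Q in H.
  eapply is_series_eq; [exact H| |].
  - intros k. cbv beta. pose proof (quartic_pos tau (freq k) Htau). rewrite H3 in *. field. lra.
  - replace (sinh tau) with (2 * (sinh tau / 2)) by field.
    replace (sin tau) with (2 * (sin tau / 2)) by field.
    rewrite <- H1, <- H2. field. lra.
Qed.

(** The weights p = P + Q, q = -(P - Q) remove the [freq k ^ 2] part instead. The mean survives as
    2/tau, half of what the summand would be at frequency 0. *)
Lemma sinh_add_sin_series (tau : R) : 0 < tau ->
  is_series (fun k => 16 * tau ^ 3 / (freq k ^ 4 + 4 * tau ^ 4))
    ((sinh tau + sin tau) / (cosh tau - cos tau) - 2 / tau).
Proof.
  intros Htau. pose proof (cosh_sub_cos_pos tau Htau) as HE.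
  destruct (sinh_sin_half tau) as [H1 H2]. pose proof (cosh_sub_cos_half tau) as H3.
  set (P := sinh (tau / 2) * cos (tau / 2)) in *.
  set (Q := cosh (tau / 2) * sin (tau / 2)) in *.
  pose proof (is_series_mult_l _ (2 / (cosh tau - cos tau)) _
                (ccos_ssin_series tau (P + Q) (- (P - Q)) Htau)) as H.
  cbv zeta in H. fold P Q in H.
  eapply is_series_eq; [exact H| |].
  - intros k. cbv beta. pose proof (quartic_pos tau (freq k) Htau). rewrite H3 in *. field. lra.
  - replace (sinh tau) with (2 * (sinh tau / 2)) by field.
    replace (sin tau) with (2 * (sin tau / 2)) by field.
    rewrite <- H1, <- H2. rewrite H3 in *. field. lra.
Qed.

(** * Interchange of the two summations *)

Lemma sum_n_S (u : nat -> R) (n : nat) : sum_n u (S n) = sum_n u n + u (S n) :> R.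
Proof. exact (sum_Sn u n). Qed.

Lemma sum_n_le_Series (u : nat -> R) (N : nat) :
  (forall n, 0 <= u n) -> ex_series u -> sum_n u N <= Series u.
Proof.
  intros Hu Hex. apply (is_lim_seq_incr_compare (sum_n u)).
  - exact (Series_correct u Hex).
  - intros n. rewrite sum_n_S. specialize (Hu (S n)). lra.
Qed.

Lemma is_lim_seq_sum_n (d : nat -> nat -> R) (N : nat) :
  (forall n, is_lim_seq (fun M => d M n) 0) ->
  is_lim_seq (fun M => sum_n (d M) N) 0.
Proof.
  intros Hd. induction N as [|N IH].
  - apply is_lim_seq_ext with (fun M => d M 0%nat); [|apply Hd].
    intros M. now rewrite sum_O.
  - apply is_lim_seq_ext with (fun M => sum_n (d M) N + d M (S N)).
    { intros M. now rewrite sum_n_S. }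
    replace (Finite 0) with (Finite (0 + 0)) by (f_equal; ring).
    now apply is_lim_seq_plus'.
Qed.

Lemma ex_series_Rabs_le (u b : nat -> R) :
  (forall n, Rabs (u n) <= b n) -> ex_series b -> ex_series u.
Proof. apply (ex_series_le (V := R_CompleteNormedModule)). Qed.

(** Dominated convergence for series: finitely many terms converge one by one, and the rest is
    controlled by the tail of [b], uniformly in [M]. *)
Lemma tannery (f : nat -> nat -> R) (g b : nat -> R) :
  ex_series b -> (forall M n, Rabs (f M n) <= b n) ->
  (forall n, is_lim_seq (fun M => f M n) (g n)) ->
  ex_series g /\ is_lim_seq (fun M => Series (f M)) (Series g).
Proof.
  intros Hb Hf Hg.
  assert (Hgb : forall n, Rabs (g n) <= b n).
  { intros n.
    apply (is_lim_seq_le (fun M => Rabs (f M n)) (fun _ => b n) (Rabs (g n)) (b n)); auto.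
    - apply (is_lim_seq_abs _ (g n)). apply Hg.
    - apply is_lim_seq_const. }
  assert (Exg : ex_series g) by now apply ex_series_Rabs_le with b.
  assert (Exf : forall M, ex_series (f M)) by (intros M; apply ex_series_Rabs_le with b; auto).
  split; auto.
  set (d := fun M n => Rabs (f M n - g n)).
  assert (Hd2 : forall M n, d M n <= 2 * b n).
  { intros M n. unfold d. pose proof (Rabs_triang (f M n) (- g n)).
    rewrite Rabs_Ropp in H. specialize (Hf M n). specialize (Hgb n).
    unfold Rminus. lra. }
  assert (Exb2 : ex_series (fun n => 2 * b n))
    by (apply (ex_series_scal_l (V := R_NormedModule)); auto).
  assert (Exd : forall M, ex_series (d M)).
  { intros M. apply ex_series_Rabs_le with (fun n => 2 * b n); auto.
    intros n. unfold d. rewrite Rabs_Rabsolu. apply Hd2. }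
  (* The part of [d M] beyond [N] is at most twice the tail of [b]: compare a partial sum of the
     nonnegative terms [2 * b n - d M n] with their full sum. *)
  assert (Hbound : forall M N, Rabs (Series (f M) - Series g)
            <= sum_n (d M) N + 2 * (Series b - sum_n b N)).
  { intros M N. rewrite <- Series_minus by auto.
    eapply Rle_trans; [apply Series_Rabs; apply Exd|]. fold (d M).
    assert (H := sum_n_le_Series (fun n => 2 * b n - d M n) N).
    rewrite Series_minus, Series_scal_l in H by auto.
    assert (E : sum_n (fun n => 2 * b n - d M n) N = 2 * sum_n b N - sum_n (d M) N).
    { clear. induction N as [|N IH]; [rewrite !sum_O; reflexivity|].
      rewrite !sum_n_S, IH. real_eq. ring. }
    rewrite E in H. unfold d at 1. fold (d M).
    change (Series (fun n => Rabs (f M n - g n))) with (Series (d M)).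
    enough (2 * sum_n b N - sum_n (d M) N <= 2 * Series b - Series (d M)) by lra.
    apply H.
    - intros n. specialize (Hd2 M n). lra.
    - apply (ex_series_minus (V := R_NormedModule)); auto. }
  apply is_lim_seq_spec. intros eps. unfold eventually.
  assert (HB : is_lim_seq (sum_n b) (Series b)) by exact (Series_correct b Hb).
  apply is_lim_seq_spec in HB.
  (* The tail enters with factor 2 and the head with factor 1, so quarters give a total below 3/4 of
     [eps]. *)
  destruct (HB (mkposreal (eps / 4) ltac:(destruct eps; simpl; lra))) as [N HN].
  specialize (HN N (Nat.le_refl N)). simpl in HN.
  assert (HD : is_lim_seq (fun M => sum_n (d M) N) 0).
  { apply is_lim_seq_sum_n. intros n. unfold d.
    apply -> is_lim_seq_abs_0.
    replace (Finite 0) with (Finite (g n - g n)) by (f_equal; ring).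
    apply is_lim_seq_minus'; auto. apply is_lim_seq_const. }
  apply is_lim_seq_spec in HD.
  destruct (HD (mkposreal (eps / 4) ltac:(destruct eps; simpl; lra))) as [M0 HM].
  exists M0. intros M HM0. specialize (HM M HM0). simpl in HM.
  specialize (Hbound M N).
  apply Rabs_def2 in HN. rewrite Rminus_0_r in HM. apply Rabs_def2 in HM.
  destruct eps as [e He]; simpl in *. lra.
Qed.

Lemma is_series_sum_n (u : nat -> nat -> R) (l : nat -> R) (M : nat) :
  (forall k, is_series (u k) (l k)) ->
  is_series (fun n => sum_n (fun k => u k n) M) (sum_n l M).
Proof.
  intros H. induction M as [|M IH].
  - apply is_series_eq with (u 0%nat) (l 0%nat); auto; intros; now rewrite sum_O.
  - eapply is_series_eq; [apply (is_series_lin _ _ 1 _ _ IH (H (S M)))| |].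
    + intros n. rewrite sum_n_S. real_eq. ring.
    + rewrite sum_n_S. real_eq. ring.
Qed.

(** Summation by parts, with the variation of [c] dominated by the telescoping decrease of [v]; [c]
    itself need not be monotone. *)
Lemma abel_bound (b c v : nat -> R) (B : R) (n : nat) :
  (forall k, Rabs (sum_n b k) <= B) ->
  (forall k, Rabs (c k - c (S k)) <= v k - v (S k)) ->
  (forall k, Rabs (c k) <= v k) ->
  Rabs (sum_n (fun k => b k * c k) n) <= B * v 0%nat.
Proof.
  intros HB Hc Hv.
  assert (B0 : 0 <= B) by (pose proof (HB 0%nat); pose proof (Rabs_pos (sum_n b 0)); lra).
  (* Removing the boundary term leaves the sum of [sum_n b k * (c k - c (S k))], which grows by one
     term at each induction step. *)
  assert (H : Rabs (sum_n (fun k => b k * c k) n - sum_n b n * c n) <= B * (v 0%nat - v n)).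
  { induction n as [|n IH].
    - rewrite !sum_O, !Rminus_diag, Rabs_R0. lra.
    - rewrite !sum_n_S.
      replace (_ - _) with ((sum_n (fun k => b k * c k) n - sum_n b n * c n)
                            + sum_n b n * (c n - c (S n))) by (real_eq; ring).
      eapply Rle_trans; [apply Rabs_triang|]. rewrite Rabs_mult.
      pose proof (Rmult_le_compat _ _ _ _ (Rabs_pos _) (Rabs_pos _) (HB n) (Hc n)). lra. }
  replace (sum_n (fun k => b k * c k) n)
    with ((sum_n (fun k => b k * c k) n - sum_n b n * c n) + sum_n b n * c n) by (real_eq; ring).
  eapply Rle_trans; [apply Rabs_triang|]. rewrite Rabs_mult.
  pose proof (Rmult_le_compat _ _ _ _ (Rabs_pos _) (Rabs_pos _) (HB n) (Hv n)). lra.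
Qed.

Lemma Rabs_div_le (x y c : R) : 0 < y -> Rabs x <= c * y -> Rabs (x / y) <= c.
Proof.
  intros Hy H. unfold Rdiv. rewrite Rabs_mult, Rabs_inv, (Rabs_pos_eq y) by lra.
  apply Rle_div_l; auto.
Qed.

(** From (x + w)^2 <= 2(x^2 + w^2): the left side is at most 2e/((x + w - e)(x + w)), which
    telescopes when w advances by steps of e. *)
Lemma variation_bound (x w e : R) : 0 < x -> 0 < e -> e <= w ->
  e / (x ^ 2 + w ^ 2) <= 2 / (x + w - e) - 2 / (x + w).
Proof.
  intros Hx He Hw.
  replace (2 / (x + w - e) - 2 / (x + w)) with (e * (2 / ((x + w - e) * (x + w)))) by (field; lra).
  unfold Rdiv at 1. apply Rmult_le_compat_l; [lra|].
  assert (0 < x ^ 2 + w ^ 2) by nra.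
  assert (0 < (x + w - e) * (x + w)) by (apply Rmult_lt_0_compat; lra).
  apply Rle_div_r; [lra|]. apply Rmult_le_reg_l with (x ^ 2 + w ^ 2); [lra|].
  rewrite <- Rmult_assoc, Rinv_r, Rmult_1_l by lra.
  pose proof (pow2_ge_0 (x - w)). assert (0 < e * (x + w)) by (apply Rmult_lt_0_compat; lra).
  nra.
Qed.

(** The difference has numerator e x(2w + e), and x(2w + e) <= x^2 + (w + e)^2 cancels one factor of
    the denominator. *)
Lemma cos_coefficient_variation (x w e : R) : 0 < x -> 0 < e -> e <= w ->
  Rabs (x / (x ^ 2 + w ^ 2) - x / (x ^ 2 + (w + e) ^ 2)) <= 2 / (x + w - e) - 2 / (x + w).
Proof.
  intros Hx He Hw. eapply Rle_trans; [|now apply variation_bound].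
  replace (_ - _) with (e * (x * (w + (w + e))) / ((x ^ 2 + w ^ 2) * (x ^ 2 + (w + e) ^ 2)))
    by (field; nra).
  apply Rabs_div_le; [apply Rmult_lt_0_compat; nra|].
  replace (e / (x ^ 2 + w ^ 2) * ((x ^ 2 + w ^ 2) * (x ^ 2 + (w + e) ^ 2)))
    with (e * (x ^ 2 + (w + e) ^ 2)) by (field; nra).
  rewrite Rabs_mult, (Rabs_pos_eq e) by lra. apply Rmult_le_compat_l; [lra|].
  assert (0 < x * w) by (apply Rmult_lt_0_compat; lra).
  assert (0 < x * e) by (apply Rmult_lt_0_compat; lra).
  pose proof (pow2_ge_0 (x - (w + e))). rewrite Rabs_pos_eq; nra.
Qed.

Lemma sin_coefficient_variation (x w e : R) : 0 < x -> 0 < e -> e <= w ->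
  Rabs (w / (x ^ 2 + w ^ 2) - (w + e) / (x ^ 2 + (w + e) ^ 2)) <= 2 / (x + w - e) - 2 / (x + w).
Proof.
  intros Hx He Hw. eapply Rle_trans; [|now apply variation_bound].
  replace (_ - _) with (e * (w * (w + e) - x ^ 2) / ((x ^ 2 + w ^ 2) * (x ^ 2 + (w + e) ^ 2)))
    by (field; nra).
  apply Rabs_div_le; [apply Rmult_lt_0_compat; nra|].
  replace (e / (x ^ 2 + w ^ 2) * ((x ^ 2 + w ^ 2) * (x ^ 2 + (w + e) ^ 2)))
    with (e * (x ^ 2 + (w + e) ^ 2)) by (field; nra).
  rewrite Rabs_mult, (Rabs_pos_eq e) by lra. apply Rmult_le_compat_l; [lra|].
  assert (0 < w * (w + e)) by (apply Rmult_lt_0_compat; lra).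
  assert (0 < e * (w + e)) by (apply Rmult_lt_0_compat; lra).
  pose proof (pow2_ge_0 x). apply Rabs_le. split; nra.
Qed.

Lemma freq_S (k : nat) : freq (S k) = freq k + 2 * PI.
Proof. unfold freq. rewrite (S_INR (S k)). ring. Qed.

Lemma freq_ge_2PI (k : nat) : 2 * PI <= freq k.
Proof.
  pose proof PI_RGT_0. unfold freq. rewrite S_INR. pose proof (pos_INR k). nra.
Qed.

(** Multiplying by 2 sin(pi a) telescopes the sum, as for the Dirichlet kernel. *)
Lemma sum_n_cos_freq_bound (a : R) (n : nat) : 0 < a < 1 ->
  Rabs (sum_n (fun k => cos (freq k * a)) n) <= / sin (PI * a).
Proof.
  intros Ha. pose proof PI_RGT_0.
  assert (Hs : 0 < sin (PI * a)) by (apply sin_gt_0; nra).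
  assert (E : sum_n (fun k => cos (freq k * a)) n
              = (sin (freq n * a + PI * a) - sin (PI * a)) / (2 * sin (PI * a))).
  { induction n as [|n IH].
    - rewrite sum_O. unfold freq. simpl INR.
      replace (2 * PI * 1 * a) with (2 * (PI * a)) by ring.
      rewrite sin_plus, sin_2a, cos_2a_sin.
      pose proof (sin2_cos2 (PI * a)) as E. unfold Rsqr in E.
      replace (2 * sin (PI * a) * cos (PI * a) * cos (PI * a))
        with (2 * sin (PI * a) * (1 - sin (PI * a) * sin (PI * a))) by (rewrite <- E; ring).
      real_eq. field. lra.
    - rewrite sum_n_S, IH.
      replace (freq n * a + PI * a) with (freq (S n) * a - PI * a) by (rewrite freq_S; ring).
      rewrite sin_plus, sin_minus. real_eq. field. lra. }
  rewrite E. apply Rabs_div_le; [lra|].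
  replace (/ sin (PI * a) * (2 * sin (PI * a))) with 2 by (field; lra).
  pose proof (SIN_bound (PI * a)). pose proof (SIN_bound (freq n * a + PI * a)).
  apply Rabs_le. lra.
Qed.

Lemma sum_n_sin_freq_bound (a : R) (n : nat) : 0 < a < 1 ->
  Rabs (sum_n (fun k => sin (freq k * a)) n) <= / sin (PI * a).
Proof.
  intros Ha. pose proof PI_RGT_0.
  assert (Hs : 0 < sin (PI * a)) by (apply sin_gt_0; nra).
  assert (E : sum_n (fun k => sin (freq k * a)) n
              = (cos (PI * a) - cos (freq n * a + PI * a)) / (2 * sin (PI * a))).
  { induction n as [|n IH].
    - rewrite sum_O. unfold freq. simpl INR.
      replace (2 * PI * 1 * a) with (2 * (PI * a)) by ring.
      rewrite cos_plus, sin_2a, cos_2a_sin. real_eq. field. lra.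
    - rewrite sum_n_S, IH.
      replace (freq n * a + PI * a) with (freq (S n) * a - PI * a) by (rewrite freq_S; ring).
      rewrite cos_plus, cos_minus. real_eq. field. lra. }
  rewrite E. apply Rabs_div_le; [lra|].
  replace (/ sin (PI * a) * (2 * sin (PI * a))) with 2 by (field; lra).
  pose proof (COS_bound (PI * a)). pose proof (COS_bound (freq n * a + PI * a)).
  apply Rabs_le. lra.
Qed.

(** The majorant for Tannery's theorem: uniform in [n] and of order 1/x, hence summable along x =
    n^2 alpha. The cosine and sine parts contribute 4/(x sin(pi a)) each. *)
Lemma fourier_partial_sum_bound (a x : R) (n : nat) : 0 < a < 1 -> 0 < x ->
  Rabs (sum_n (fourier_term a x) n) <= 8 / sin (PI * a) * / x.
Proof.
  intros Ha Hx. pose proof PI_RGT_0.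
  assert (Hs : 0 < sin (PI * a)) by (apply sin_gt_0; nra).
  (* This is the telescoping bound of the variation lemmas with step e = 2 pi; since [freq 0] is 2
     pi, [v 0] is exactly 2/x. *)
  set (v := fun k => 2 / (x + freq k - 2 * PI)).
  assert (Hv : forall k, v (S k) = 2 / (x + freq k)).
  { intros k. unfold v. rewrite freq_S. f_equal. ring. }
  assert (Hv0 : v 0%nat = 2 / x).
  { unfold v, freq. simpl INR. f_equal. ring. }
  assert (H1 := abel_bound (fun k => cos (freq k * a)) (fun k => x / (x ^ 2 + freq k ^ 2)) v
                  (/ sin (PI * a)) n).
  assert (H2 := abel_bound (fun k => sin (freq k * a)) (fun k => freq k / (x ^ 2 + freq k ^ 2)) v
                  (/ sin (PI * a)) n).
  assert (E : sum_n (fourier_term a x) n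
     = 2 * sum_n (fun k => cos (freq k * a) * (x / (x ^ 2 + freq k ^ 2))) n
     + 2 * sum_n (fun k => sin (freq k * a) * (freq k / (x ^ 2 + freq k ^ 2))) n).
  { clear - Hx. induction n as [|n IH].
    - rewrite !sum_O. unfold fourier_term. real_eq. field. nra.
    - rewrite !sum_n_S, IH. unfold fourier_term. real_eq. field. nra. }
  rewrite E. rewrite Hv0 in H1, H2.
  replace (8 / sin (PI * a) * / x)
    with (2 * (/ sin (PI * a) * (2 / x)) + 2 * (/ sin (PI * a) * (2 / x))) by (field; lra).
  eapply Rle_trans; [apply Rabs_triang|]. rewrite !Rabs_mult, (Rabs_pos_eq 2) by lra.
  apply Rplus_le_compat; (apply Rmult_le_compat_l; [lra|]); [apply H1|apply H2]; intros k;
    pose proof (freq_ge_2PI k).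
  - now apply sum_n_cos_freq_bound.
  - rewrite Hv, freq_S. apply cos_coefficient_variation; lra.
  - apply Rabs_div_le; [nra|]. rewrite Rabs_pos_eq by lra. unfold v.
    apply Rmult_le_reg_r with (x + freq k - 2 * PI); [lra|]. field_simplify; [|lra]. nra.
  - now apply sum_n_sin_freq_bound.
  - rewrite Hv, freq_S. apply sin_coefficient_variation; lra.
  - apply Rabs_div_le; [nra|]. rewrite Rabs_pos_eq by lra. unfold v.
    apply Rmult_le_reg_r with (x + freq k - 2 * PI); [lra|]. field_simplify; [|lra]. nra.
Qed.

Lemma is_series_inv_sqr (alpha : R) : 0 < alpha ->
  is_series (fun n => / (INR (S n) ^ 2 * alpha)) (PI ^ 2 / (6 * alpha)).
Proof.
  intros Halpha.
  eapply is_series_eq; [apply (is_series_mult_l _ (/ alpha) _ basel_series)| |].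
  - intros n. cbv beta. pose proof (lt_0_INR (S n) ltac:(lia)). field. lra.
  - field. lra.
Qed.

(** A partial sum of the column sums [l] is the sum over [n] of partial Fourier sums; Tannery's
    theorem passes to the limit inside. The 1/x terms are summed apart by the Basel series. *)
Lemma lambert_series_interchange (alpha a : R) (l : nat -> R) : 0 < alpha -> 0 < a < 1 ->
  (forall k, is_series (fun n => fourier_term a (INR (S n) ^ 2 * alpha) k) (l k)) ->
  exists S0 : R, is_series (fun n => exp (- a * (INR (S n) ^ 2 * alpha))
                                 / (1 - exp (- (INR (S n) ^ 2 * alpha)))) S0 /\
             is_series l (S0 - PI ^ 2 / (6 * alpha)).
Proof.
  intros Halpha Ha Hl.
  set (x := fun n => INR (S n) ^ 2 * alpha).
  assert (Hx : forall n, 0 < x n).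
  { intros n. unfold x. pose proof (lt_0_INR (S n) ltac:(lia)). apply Rmult_lt_0_compat; nra. }
  set (g := fun n => exp (- a * x n) / (1 - exp (- x n)) - / x n).
  assert (Hxi : is_series (fun n => / x n) (PI ^ 2 / (6 * alpha)))
    by now apply is_series_inv_sqr.
  destruct (tannery (fun M n => sum_n (fourier_term a (x n)) M) g
              (fun n => 8 / sin (PI * a) * / x n)) as [Hg Hlim].
  - apply (ex_series_scal_l (V := R_NormedModule)). now exists (PI ^ 2 / (6 * alpha)).
  - intros M n. now apply fourier_partial_sum_bound.
  - intros n. now apply exp_partial_fractions.
  - apply Series_correct in Hg. exists (Series g + PI ^ 2 / (6 * alpha)). split.
    + eapply is_series_eq; [apply (is_series_lin _ _ 1 _ _ Hg Hxi)| |].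
      * intros n. unfold g. fold (x n). ring.
      * ring.
    + replace (Series g + PI ^ 2 / (6 * alpha) - PI ^ 2 / (6 * alpha)) with (Series g) by ring.
      change (is_lim_seq (sum_n l) (Series g)).
      apply (is_lim_seq_ext (fun M => Series (fun n => sum_n (fourier_term a (x n)) M)));
        [|exact Hlim].
      intros M. apply is_series_unique.
      now apply (is_series_sum_n (fun k n => fourier_term a (x n) k)).
Qed.

(** With w = [freq k], the condition on [alpha * beta] gives tau^2 = 2 pi^2 w/alpha. Hence for x =
    n^2 alpha, x^2 + w^2 is a constant multiple of (2 pi n)^4 + 4 tau^4, and the column combines the
    two closed forms above. *)
Lemma fourier_term_column (alpha beta a : R) (k : nat) :
  0 < alpha -> 0 < beta -> alpha * beta = 4 * PI ^ 3 ->
  is_series (fun n => fourier_term a (INR (S n) ^ 2 * alpha) k)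
    (PI ^ 2 / (alpha * sqrt (INR (S k) * beta))
     * (cos (freq k * a) * ratio_minus beta (S k) + sin (freq k * a) * ratio_plus beta (S k))
     - sin (freq k * a) / freq k).
Proof.
  intros Halpha Hbeta Hab. pose proof PI_RGT_0 as Hpi.
  pose proof (lt_0_INR (S k) ltac:(lia)) as Hk.
  unfold ratio_minus, ratio_plus. cbv zeta.
  set (tau := sqrt (INR (S k) * beta)).
  assert (Hkb : 0 < INR (S k) * beta) by now apply Rmult_lt_0_compat.
  assert (Htau : 0 < tau) by now apply sqrt_lt_R0.
  assert (Htau2 : tau ^ 2 = freq k * (2 * PI ^ 2 / alpha)).
  { unfold tau. rewrite pow2_sqrt by lra. unfold freq.
    replace beta with (4 * PI ^ 3 / alpha) by (rewrite <- Hab; field; lra). field. lra. }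
  pose proof (freq_gt_0 k) as Hf. set (w := freq k) in *.
  assert (H1 := is_series_mult_l _ (PI ^ 2 / (alpha * tau) * cos (w * a)) _
                  (sinh_sub_sin_series tau Htau)).
  pose proof (is_series_lin _ _ (PI ^ 2 / (alpha * tau) * sin (w * a)) _ _
                H1 (sinh_add_sin_series tau Htau)) as H2.
  eapply is_series_eq; [exact H2| |].
  - intros n. cbv beta. pose proof (lt_0_INR (S n) ltac:(lia)) as Hn.
    pose proof (quartic_pos tau (freq n) Htau) as HD.
    replace (tau ^ 4) with ((tau ^ 2) ^ 2) in * by ring.
    replace (16 * tau ^ 3) with (16 * tau * tau ^ 2) by ring.
    unfold fourier_term. fold w.
    transitivity (PI ^ 2 / alpha * (8 * freq n ^ 2 * cos (w * a) + 16 * tau ^ 2 * sin (w * a))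
                  / (freq n ^ 4 + 4 * (tau ^ 2) ^ 2)); [field; lra|].
    rewrite Htau2 in *. change (freq n) with (2 * PI * INR (S n)) in *. set (N := INR (S n)) in *.
    assert (HwPI : 0 < w ^ 2 * (4 * PI ^ 4)).
    { apply Rmult_lt_0_compat; [now apply pow_lt|]. pose proof (pow_lt PI 4 Hpi). lra. }
    assert (HN : 0 < (2 * PI * N) ^ 4 * alpha ^ 2).
    { apply Rmult_lt_0_compat; apply pow_lt; auto. apply Rmult_lt_0_compat; [lra|exact Hn]. }
    real_eq. field. repeat split; [|lra|lra].
    pose proof (pow_lt w 2 Hf). pose proof (pow2_ge_0 (N ^ 2 * alpha)). lra.
  - cbv beta.
    (* The term -2/tau of [sinh_add_sin_series] turns into the sawtooth term. *)
    replace (sin (w * a) / w) with (2 * PI ^ 2 / (alpha * tau ^ 2) * sin (w * a))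
      by (rewrite Htau2; field; lra).
    real_eq. field. pose proof (cosh_sub_cos_pos tau Htau). lra.
Qed.

(** * Assembling the identity *)

Lemma sqrt_prefactor (alpha beta m : R) :
  0 < alpha -> 0 < beta -> 0 < m -> alpha * beta = 4 * PI ^ 3 ->
  PI ^ 2 / (alpha * sqrt (m * beta)) = sqrt PI / (2 * sqrt alpha) / sqrt m.
Proof.
  intros Halpha Hbeta Hm Hab. pose proof PI_RGT_0 as Hpi.
  assert (E : sqrt alpha * sqrt beta = 2 * PI * sqrt PI).
  { rewrite <- sqrt_mult by lra. rewrite Hab.
    replace (4 * PI ^ 3) with ((2 * PI) ^ 2 * PI) by ring.
    rewrite sqrt_mult, sqrt_pow2 by nra. ring. }
  rewrite sqrt_mult by lra.
  pose proof (sqrt_lt_R0 _ Halpha) as Ha. pose proof (sqrt_lt_R0 _ Hm) as Hsm.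
  pose proof (sqrt_lt_R0 _ Hpi) as Hp. pose proof (sqrt_lt_R0 _ Hbeta) as Hb.
  rewrite <- (sqrt_sqrt alpha) at 1 by lra.
  transitivity (PI ^ 2 / (sqrt alpha * sqrt m * (sqrt alpha * sqrt beta))).
  { field. repeat split; lra. }
  rewrite E. transitivity (PI / (2 * sqrt alpha * sqrt m * sqrt PI)).
  { field. repeat split; lra. }
  rewrite <- (sqrt_sqrt PI) at 1 by lra. field. repeat split; lra.
Qed.

(** Adding the sawtooth series cancels the last term of every column and supplies the linear term in
    [a]. Cosine and sine terms remain in one series, since the interchange yields convergence only
    of their sum. *)
Lemma lambert_series_combined (alpha beta a : R) :
  0 < alpha -> 0 < beta -> alpha * beta = 4 * PI ^ 3 -> 0 < a < 1 ->
  exists S0 : R,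
    is_series (fun n => exp (- a * (INR (S n) ^ 2 * alpha))
                        / (1 - exp (- (INR (S n) ^ 2 * alpha)))) S0 /\
    is_series (fun k => cos (freq k * a) / sqrt (INR (S k)) * ratio_minus beta (S k)
                        + sin (freq k * a) / sqrt (INR (S k)) * ratio_plus beta (S k))
      (2 * sqrt alpha / sqrt PI * (S0 - / 2 * (a - / 2) - PI ^ 2 / (6 * alpha))).
Proof.
  intros Halpha Hbeta Hab Ha.
  pose proof (sqrt_lt_R0 _ Halpha) as Hsa. pose proof (sqrt_lt_R0 _ PI_RGT_0) as Hsp.
  destruct (lambert_series_interchange alpha a _ Halpha Ha
              (fun k => fourier_term_column alpha beta a k Halpha Hbeta Hab)) as [S0 [H0 H1]].
  exists S0. split; auto.
  pose proof (is_series_mult_l _ (2 * sqrt alpha / sqrt PI) _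
                (is_series_lin _ _ 1 _ _ H1 (sawtooth_series a Ha))) as H2.
  eapply is_series_eq; [exact H2| |].
  - intros k. cbv beta. pose proof (lt_0_INR (S k) ltac:(lia)) as Hk.
    rewrite (sqrt_prefactor alpha beta (INR (S k))) by auto.
    pose proof (sqrt_lt_R0 _ Hk). pose proof (freq_gt_0 k). field. repeat split; lra.
  - field. lra.
Qed.

Lemma cos_PI_mult_INR (n : nat) : cos (PI * INR n) = (-1) ^ n.
Proof.
  induction n as [|n IH].
  - rewrite Rmult_0_r. apply cos_0.
  - rewrite S_INR, Rmult_plus_distr_l, Rmult_1_r, neg_cos, IH. simpl. ring.
Qed.

Lemma sin_PI_mult_INR (n : nat) : sin (PI * INR n) = 0.
Proof.
  induction n as [|n IH].
  - rewrite Rmult_0_r. apply sin_0.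
  - rewrite S_INR, Rmult_plus_distr_l, Rmult_1_r, neg_sin, IH. ring.
Qed.

Lemma cosech_exp (x : R) : 0 < x -> cosech (x / 2) = 2 * (exp (- / 2 * x) / (1 - exp (- x))).
Proof.
  intros Hx. pose proof (exp_opp_lt_1 x Hx) as Hlt. unfold cosech, sinh.
  replace (- / 2 * x) with (- (x / 2)) by field.
  replace (- x) with (- (x / 2) + - (x / 2)) in * by field.
  rewrite exp_plus, exp_Ropp in *. pose proof (exp_pos (x / 2)) as Hp.
  assert (1 < exp (x / 2)) by (rewrite <- exp_0; apply exp_increasing; lra).
  field. repeat split; nra.
Qed.

(* Series over n >= 1 are written as series over k >= 0 with n = k + 1;
   "sum_{n>=1} u_n = S" is rendered as is_series (convergence of partial sums). *)
Theorem theorem1p22 (alpha beta : R) (halpha : 0 < alpha) (hbeta : 0 < beta)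
  (hab : alpha * beta = 4 * PI ^ 3) :
  (forall a : R, 0 < a < 1 ->
    exists S0 S1 S2 : R,
      is_series (fun k : nat => let n := INR (S k) in
                   exp (- a * n ^ 2 * alpha) / (1 - exp (- n ^ 2 * alpha))) S0 /\
      is_series (fun k : nat => let n := INR (S k) in
                   cos (2 * PI * n * a) / sqrt n * ratio_minus beta (S k)) S1 /\
      is_series (fun k : nat => let n := INR (S k) in
                   sin (2 * PI * n * a) / sqrt n * ratio_plus beta (S k)) S2 /\
      S0 = / 2 * (a - / 2) + PI ^ 2 / (6 * alpha)
           + sqrt PI / (2 * sqrt alpha) * (S1 + S2))
  /\
  (exists T0 T1 : R,
      is_series (fun k : nat => let n := INR (S k) in
                   cosech (n ^ 2 * alpha / 2)) T0 /\
      is_series (fun k : nat => let n := INR (S k) in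
                   (-1) ^ (S k) / sqrt n * ratio_minus beta (S k)) T1 /\
      T0 = PI ^ 2 / (3 * alpha) + sqrt (PI / alpha) * T1).
Proof.
  pose proof (sqrt_lt_R0 _ halpha) as Hsa. pose proof (sqrt_lt_R0 _ PI_RGT_0) as Hsp.
  split.
  - intros a Ha.
    destruct (lambert_series_combined alpha beta a) as [S0 [H0 HP]]; auto.
    destruct (lambert_series_combined alpha beta (1 - a)) as [S0' [_ HQ]]; auto; [lra|].
    set (V := 2 * sqrt alpha / sqrt PI * (S0 - _ - _)) in HP.
    set (V' := 2 * sqrt alpha / sqrt PI * (S0' - _ - _)) in HQ.
    (* Replacing a by 1 - a flips the sign of the sine terms, so half the sum and half the
       difference of the two combined series isolate the cosine and the sine series. *)
    exists S0, (/ 2 * (V + 1 * V')), (/ 2 * (V + -1 * V')).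
    split; [|split; [|split]].
    + apply is_series_eq with (1 := H0); auto.
      intros n. cbv zeta.
      now rewrite !Rmult_assoc, Ropp_mult_distr_l.
    + eapply is_series_eq; [apply is_series_mult_l, is_series_lin; [exact HP|exact HQ]| |auto].
      intros k. cbv beta zeta. unfold freq. rewrite cos_2PI_mult_sub, sin_2PI_mult_sub. real_eq. field.
      pose proof (sqrt_lt_R0 _ (lt_0_INR (S k) ltac:(lia))). lra.
    + eapply is_series_eq; [apply is_series_mult_l, is_series_lin; [exact HP|exact HQ]| |auto].
      intros k. cbv beta zeta. unfold freq. rewrite cos_2PI_mult_sub, sin_2PI_mult_sub. real_eq. field.
      pose proof (sqrt_lt_R0 _ (lt_0_INR (S k) ltac:(lia))). lra.
    (* The half sum and the half difference add up to [V], which is solved for [S0]. *)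
    + transitivity (/ 2 * (a - / 2) + PI ^ 2 / (6 * alpha) + sqrt PI / (2 * sqrt alpha) * V).
      * unfold V. real_eq. field. lra.
      * real_eq. field. lra.
  (* At a = 1/2 the sine terms and the linear term vanish, so the combined series is already the
     wanted one; the factor 2 comes from [cosech_exp]. *)
  - destruct (lambert_series_combined alpha beta (/ 2)) as [S0 [H0 HP]]; auto; [lra|].
    eexists (2 * S0), _. split; [|split].
    + eapply is_series_eq; [apply (is_series_mult_l _ 2 _ H0)| |reflexivity].
      intros k. cbv beta zeta. symmetry. apply cosech_exp.
      apply Rmult_lt_0_compat; auto. apply pow_lt, lt_0_INR. lia.
    + eapply is_series_eq; [exact HP| |reflexivity].
      intros k. cbv beta zeta. unfold freq.
      replace (2 * PI * INR (S k) * / 2) with (PI * INR (S k)) by field.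
      rewrite cos_PI_mult_INR, sin_PI_mult_INR. unfold Rdiv. real_eq. ring.
    + rewrite sqrt_div by (pose proof PI_RGT_0; lra). field. lra.
Qed.
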